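(* Let $0\le k<p$ and let $\Pi=(\{1,\ldots,k\},\{k+1,\ldots,p\})$. Let $s^1:\mathbb{R}^k\to\mathbb{R}_{\ge}$ be a strictly monotone norm on $\mathbb{R}^k$ and $s^2:\mathbb{R}^{p-k}\to\mathbb{R}_{\ge}$ a strictly monotone norm on $\mathbb{R}^{p-k}$, and let $s:\mathbb{R}^p_>\to\mathbb{R}$, $s(y)=s^1(y_1,\ldots,y_k)-s^2(y_{k+1},\ldots,y_p)$. Let $S=\{s_w : w\in\mathbb{R}^p_>\}$ be the weighted scalarization induced by $W=\mathbb{R}^p_>$ and $s$, where $s_w:\mathbb{R}^p_>\to\mathbb{R}$, $s_w(y)=s(w_1y_1,\ldots,w_py_p)$. Then: 1. For any $\alpha\ge 1$, there exists an instance of a $p$-objective optimization problem of type $\Pi$ such that the set of $S$-supported solutions is not an $\alpha$-approximation set. 2. It holds that $$\inf_{\bar y \in \mathbb{R}^p_>} \ \sup \left\{\max \left\{ \frac{y^*_1}{\bar{y}_1}, \ldots, \frac{y^*_k}{\bar{y}_k}, \frac{\bar{y}_{k+1}}{y^*_{k+1}},\ldots,\frac{\bar{y}_{p}}{y^*_{p}} \right\}\ \middle|\ y^* \in L(\bar{y},s)\right\}=\infty.$$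
   Context: The number of objectives $p \in \mathbb{N}\setminus\{0\}$ is a fixed constant. $\mathbb{R}^n_> = \{y \in \mathbb{R}^n : y_i > 0 \text{ for } i=1,\ldots,n\}$ and $\mathbb{R}_{\ge}=[0,\infty)$. A norm $t$ on $\mathbb{R}^n$ is called strictly monotone (strictly $(\{1,\ldots,n\},\emptyset)$-monotone) if for all $y,y'\in\mathbb{R}^n_>$ with $y_i<y'_i$ for all $i$ one has $t(y)<t(y')$. If $k=0$, the term $s^1$ is the zero norm on $\mathbb{R}^0$, so $s(y)=-s^2(y)$. The level set is $L(\bar y,s)=\{y\in\mathbb{R}^p_> : s(y)=s(\bar y)\}$. $\Pi = (\{1,\ldots,k\},\{k+1,\ldots,p\})$ means that objectives $1,\ldots,k$ are to be minimized and objectives $k+1,\ldots,p$ are to be maximized. A $p$-objective optimization problem of type $\Pi$ is a set of instances; each instance $(X,f)$ consists of a set $X$ of feasible solutions and a vector $f=(f_1,\ldots,f_p)$ of objective functions on $X$. Standing assumption: in every instance, $f(X)$ is a compact subset of $\mathbb{R}^p_>$. For $\alpha\ge 1$, $x\in X$ $\alpha$-approximates $x' \in X$ if $f_i(x) \le \alpha f_i(x')$ for $i=1,\ldots,k$ and $f_i(x) \ge \frac1\alpha f_i(x')$ for $i=k+1,\ldots,p$. A set $P\subseteq X$ is an $\alpha$-approximation set if every $x'\in X$ is $\alpha$-approximated by some $x\in P$. In an instance $(X,f)$, $x\in X$ is $S$-supported if there is $s_w\in S$ such that $s_w(f(x))\le s_w(f(x'))$ for all $x'\in X$.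
   Formalization: The formal theorem assumes p ≥ 2, which excludes only k = 0, p = 1; there s(y) = −cy with c > 0, each level set is the single point ȳ, the infimum is 1, and the supported solutions form a 1-approximation set, so both parts fail. *)

(* Defs.v *)
From mathcomp Require Import all_boot all_order all_algebra.
From mathcomp Require Import all_classical all_reals all_analysis.

Set Implicit Arguments.
Unset Strict Implicit.
Unset Printing Implicit Defensive.

Import Order.TTheory GRing.Theory Num.Theory.
Import numFieldNormedType.Exports.
Local Open Scope classical_set_scope.
Local Open Scope ring_scope.

(* A type Pi = ({1,...,k}, {k+1,...,p}) is given by the pair (k, m) with
   m = p - k; vectors of R^p are row vectors of size k + m.  The objectives
   lshift m i (i : 'I_k) are minimized and the objectives rshift k j
   (j : 'I_m) are maximized. *)

Definition posvec (R : realType) (n : nat) : set 'rV[R]_n :=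
  [set y | forall i, 0 < y 0 i].
Arguments posvec : clear implicits.

(* The library has normed spaces as structures on a type, but no predicate
   saying that a given function is a norm. *)
Record is_norm (R : realType) (n : nat) (t : 'rV[R]_n -> R) : Prop := IsNorm {
  is_norm_ge0 : forall y, 0 <= t y;
  is_norm_eq0 : forall y, t y = 0 -> y = 0;
  is_normZ : forall (a : R) y, t (a *: y) = `|a| * t y;
  is_normD : forall y z, t (y + z) <= t y + t z
}.

(* For n = 0 no function satisfies this: the hypotheses on y and z are then
   vacuous and y = z. *)
Definition strictly_monotone (R : realType) (n : nat) (t : 'rV[R]_n -> R) :=
  forall y z, posvec R n y -> posvec R n z ->
    (forall i, y 0 i < z 0 i) -> t y < t z.

(* Scalarizations are total functions on R^p, of which only the values on
   posvec matter; likewise below for weighted and level_set. *)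
Definition diff_scal (R : realType) (k m : nat)
    (s1 : 'rV[R]_k -> R) (s2 : 'rV[R]_m -> R) (y : 'rV[R]_(k + m)) : R :=
  s1 (lsubmx y) - s2 (rsubmx y).

Definition weighted (R : realType) (n : nat) (s : 'rV[R]_n -> R)
    (w y : 'rV[R]_n) : R :=
  s (\row_i (w 0 i * y 0 i)).

Definition weighted_scalarization (R : realType) (n : nat)
    (W : set 'rV[R]_n) (s : 'rV[R]_n -> R) : set ('rV[R]_n -> R) :=
  [set weighted s w | w in W].

Definition level_set (R : realType) (n : nat) (ybar : 'rV[R]_n)
    (s : 'rV[R]_n -> R) : set 'rV[R]_n :=
  [set y | posvec R n y /\ s y = s ybar].

Record instance (R : realType) (k m : nat) := Instance {
  feasible : Type;
  objective : feasible -> 'rV[R]_(k + m);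
  objective_compact : compact (range objective);
  objective_pos : range objective `<=` posvec R (k + m)
}.

Definition approximates (R : realType) (k m : nat) (I : instance R k m)
    (alpha : R) (x x' : feasible I) : Prop :=
  (forall i : 'I_k, objective x 0 (lshift m i) <=
                    alpha * objective x' 0 (lshift m i)) /\
  (forall j : 'I_m, objective x 0 (rshift k j) >=
                    alpha^-1 * objective x' 0 (rshift k j)).

Arguments approximates {R k m} I alpha x x'.

Definition approximation_set (R : realType) (k m : nat) (I : instance R k m)
    (alpha : R) (P : set (feasible I)) : Prop :=
  forall x', exists2 x, P x & approximates I alpha x x'.
Arguments approximation_set {R k m} I alpha P.

Definition supported (R : realType) (k m : nat) (I : instance R k m)
    (S : set ('rV[R]_(k + m) -> R)) : set (feasible I) :=
  [set x | exists2 sw, S sw &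
             forall x' : feasible I, sw (objective x) <= sw (objective x')].
Arguments supported {R k m} I S.

(* The ratio by which y is worse than ybar in objective i if i is minimized,
   and by which ybar exceeds y in objective i if i is maximized. *)
Definition ratio (R : realType) (k m : nat) (y ybar : 'rV[R]_(k + m))
    (i : 'I_(k + m)) : R :=
  if (i < k)%N then y 0 i / ybar 0 i else ybar 0 i / y 0 i.

(* The maximum is taken in \bar R with neutral element -oo, so that it is the
   true maximum of the k + m ratios whenever 0 < k + m. *)
Definition max_ratio (R : realType) (k m : nat) (y ybar : 'rV[R]_(k + m)) :
    \bar R :=
  \big[maxe/-oo%E]_(i < k + m) (ratio y ybar i)%:E.

(* Main.v *)
(** If both kinds of objectives are present, scaling the two blocks of a vector
    by suitable factors shifts [s1] and [s2] by the same amount, so a level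
    set of [s1 - s2] is unbounded; scaling the all-ones vector blockwise by
    [(2 alpha, 2 alpha)] and by [(1 / (4 alpha), 1 / (2 alpha))] gives two
    vectors one of which beats all-ones for each weight.
    If all objectives are maximized, there are at least two of them. One
    coordinate may tend to [0] while the others keep [s2] constant, so the
    ratios are again unbounded. The vectors that are [3] everywhere except for
    a small value in the first (resp. second) coordinate add up to more than
    twice all-ones, so by the triangle inequality one of the two beats
    all-ones for each weight. *)
Require Import Defs.
From mathcomp Require Import all_boot all_order all_algebra.
From mathcomp Require Import all_classical all_reals all_analysis.
From mathcomp Require Import lra.
Import Order.TTheory GRing.Theory Num.Theory.
Import numFieldNormedType.Exports.
Local Open Scope classical_set_scope.
Local Open Scope ring_scope.

Lemma is_norm_gt0 {R : realType} {n : nat} {t : 'rV[R]_n -> R} (tN : is_norm t)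
  {y : 'rV[R]_n} : y != 0 -> 0 < t y.
Proof.
move=> y0; rewrite lt_neqAle is_norm_ge0 // andbT eq_sym.
by apply: contra y0 => /eqP /(is_norm_eq0 tN) ->.
Qed.

Lemma is_normZ_gt0 {R : realType} {n : nat} {t : 'rV[R]_n -> R}
  (tN : is_norm t) {a : R} {y : 'rV[R]_n} : 0 < a -> t (a *: y) = a * t y.
Proof. by move=> a0; rewrite (is_normZ tN) gtr0_norm. Qed.

Lemma posvec_neq0 {R : realType} {n : nat} {y : 'rV[R]_n} :
  (0 < n)%N -> posvec R n y -> y != 0.
Proof.
case: n y => // n y _ yp; apply/eqP => y0.
by have := yp ord0; rewrite y0 mxE ltxx.
Qed.

Lemma posvecZ {R : realType} {n : nat} {a : R} {y : 'rV[R]_n} :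
  0 < a -> posvec R n y -> posvec R n (a *: y).
Proof. by move=> a0 yp i; rewrite mxE mulr_gt0. Qed.

Lemma posvec_const {R : realType} {n : nat} {a : R} :
  0 < a -> posvec R n (const_mx a).
Proof. by move=> a0 i; rewrite mxE. Qed.

Lemma posvec_row_mx {R : realType} {k m : nat} {l : 'rV[R]_k} {r : 'rV[R]_m} :
  posvec R k l -> posvec R m r -> posvec R (k + m) (row_mx l r).
Proof. by move=> lp rp i; rewrite mxE; case: splitP => j _. Qed.

Lemma posvec_lsubmx {R : realType} {k m : nat} {y : 'rV[R]_(k + m)} :
  posvec R (k + m) y -> posvec R k (lsubmx y).
Proof. by move=> yp i; rewrite mxE. Qed.

Lemma posvec_rsubmx {R : realType} {k m : nat} {y : 'rV[R]_(k + m)} :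
  posvec R (k + m) y -> posvec R m (rsubmx y).
Proof. by move=> yp i; rewrite mxE. Qed.

Lemma ratio_lshift {R : realType} {k m : nat} (y z : 'rV[R]_(k + m))
  (i : 'I_k) :
  Defs.ratio y z (lshift m i) = y 0 (lshift m i) / z 0 (lshift m i).
Proof. by rewrite /Defs.ratio /= ltn_ord. Qed.

Lemma ratio_rshift {R : realType} {k m : nat} (y z : 'rV[R]_(k + m))
  (j : 'I_m) :
  Defs.ratio y z (rshift k j) = z 0 (rshift k j) / y 0 (rshift k j).
Proof. by rewrite /Defs.ratio /= ltnNge leq_addr. Qed.

Lemma diff_scal_row_mx {R : realType} {k m : nat} (s1 : 'rV[R]_k -> R)
  (s2 : 'rV[R]_m -> R) (l : 'rV[R]_k) (r : 'rV[R]_m) :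
  diff_scal s1 s2 (row_mx l r) = s1 l - s2 r.
Proof. by rewrite /diff_scal row_mxKl row_mxKr. Qed.

Lemma weighted_diff_scal {R : realType} {k m : nat} (s1 : 'rV[R]_k -> R)
  (s2 : 'rV[R]_m -> R) (w : 'rV[R]_(k + m)) (l : 'rV[R]_k) (r : 'rV[R]_m) :
  weighted (diff_scal s1 s2) w (row_mx l r) =
  weighted s1 (lsubmx w) l - weighted s2 (rsubmx w) r.
Proof.
rewrite /weighted /diff_scal; congr (s1 _ - s2 _); apply/rowP => i; rewrite !mxE.
  by rewrite (unsplitK (inl i)).
by rewrite (unsplitK (inr i)).
Qed.

(** Weighting a constant vector merely scales [w], so blockwise constant points are compared through
    the norms of the two blocks of [w] alone. *)
Lemma weighted_const {R : realType} {n : nat} {t : 'rV[R]_n -> R}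
  (tN : is_norm t) {w : 'rV[R]_n} {a : R} :
  0 < a -> weighted t w (const_mx a) = a * t w.
Proof.
move=> a0; rewrite -is_normZ_gt0 // /weighted; congr t.
by apply/rowP => i; rewrite !mxE mulrC.
Qed.

Lemma approximates_ratio_le {R : realType} {k m : nat} {I : instance R k m}
  {alpha : R} {x x' : feasible I} (i : 'I_(k + m)) :
  0 < alpha -> approximates I alpha x x' ->
  Defs.ratio (objective x) (objective x') i <= alpha.
Proof.
have pos z j : 0 < @objective _ _ _ I z 0 j by apply: objective_pos; exists z.
move=> a0 [hl hr]; case: (split_ordP i) => j ->.
  by rewrite ratio_lshift ler_pdivrMr.
by rewrite ratio_rshift ler_pdivrMr // -ler_pdivrMl.
Qed.

(** The solutions are the three indices. Solution [0] is beaten under every scalarization, hence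
    never supported, and neither of the others approximates it. *)
Lemma three_point_instance {R : realType} {k m : nat}
  (S : set ('rV[R]_(k + m) -> R)) (alpha : R) (y : 'I_3 -> 'rV[R]_(k + m)) :
  0 < alpha -> (forall j, posvec R (k + m) (y j)) ->
  (forall j, j != 0 -> exists i, alpha < Defs.ratio (y j) (y 0) i) ->
  (forall sw, S sw -> exists j, sw (y j) < sw (y 0)) ->
  exists I : instance R k m, ~ approximation_set I alpha (supported I S).
Proof.
move=> a0 yp yr yS.
have yc : compact (range y) by apply/finite_compact/finite_image.
have yP : range y `<=` posvec R (k + m) by move=> _ [j _ <-].
exists (Instance yc yP) => /(_ (0 : 'I_3))[j [sw Ssw /= jmin] japx].
have j0 : j != 0.
  apply/eqP => j0; have [i] := yS _ Ssw.
  by rewrite ltNge -j0 jmin.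
have [i] := yr _ j0.
by rewrite ltNge (approximates_ratio_le i a0 japx).
Qed.

Lemma sup_max_ratio_pinfty {R : realType} {k m : nat} (L : set 'rV[R]_(k + m))
  (ybar : 'rV[R]_(k + m)) :
  (forall c : R, 0 < c -> exists2 y, L y & exists i, c < Defs.ratio y ybar i) ->
  ereal_sup [set max_ratio y ybar | y in L] = +oo%E.
Proof.
move=> h; apply/eqyP => c c0; have [y Ly [i ci]] := h c c0.
apply: (@le_trans _ _ (max_ratio y ybar)).
  apply: (@le_trans _ _ (Defs.ratio y ybar i)%:E); first by rewrite lee_fin ltW.
  by rewrite /max_ratio; apply: le_bigmax.
by apply: ereal_sup_ubound; exists y.
Qed.

(** * Unbounded ratios on level sets *)

Lemma unbounded_ratio_mixed {R : realType} {k m : nat} (s1 : 'rV[R]_k -> R)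
  (s2 : 'rV[R]_m -> R) (s1N : is_norm s1) (s2N : is_norm s2)
  (ybar : 'rV[R]_(k + m)) (c : R) :
  (0 < k)%N -> (0 < m)%N -> posvec R (k + m) ybar -> 0 < c ->
  exists2 y, level_set ybar (diff_scal s1 s2) y & exists i, c < Defs.ratio y ybar i.
Proof.
move=> k0 m0 yp c0.
have lp := posvec_lsubmx yp; have rp := posvec_rsubmx yp.
have A0 := is_norm_gt0 s1N (posvec_neq0 k0 lp).
have B0 := is_norm_gt0 s2N (posvec_neq0 m0 rp).
set A := s1 _ in A0; set B := s2 _ in B0.
have b0 : 0 < 1 + c / B * A by rewrite ltr_pwDl // ?mulr_ge0 ?invr_ge0 ?ltW.
have c10 : 0 < 1 + c by lra.
(* Both norms grow by [c * A], so their difference is kept, while each minimized objective has ratio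
   [1 + c]. *)
exists (row_mx ((1 + c) *: lsubmx ybar) ((1 + c / B * A) *: rsubmx ybar)).
  split; first by apply: posvec_row_mx; apply: posvecZ.
  rewrite diff_scal_row_mx !is_normZ_gt0 // /diff_scal -/A -/B.
  have : c / B * A * B = c * A by rewrite mulrAC divfK // gt_eqF.
  rewrite !mulrDl !mul1r; lra.
exists (lshift m (Ordinal k0)); rewrite ratio_lshift row_mxEl !mxE.
by rewrite mulfK ?gt_eqF //; lra.
Qed.

Lemma unbounded_ratio_max {R : realType} {m : nat} (s1 : 'rV[R]_0 -> R)
  (s2 : 'rV[R]_m -> R) (s2N : is_norm s2) (ybar : 'rV[R]_(0 + m)) (c : R) :
  (1 < m)%N -> posvec R (0 + m) ybar -> 0 < c ->
  exists2 y, level_set ybar (diff_scal s1 s2) y & exists i, c < Defs.ratio y ybar i.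
Proof.
move=> m1 yp c0; have m0 := ltnW m1.
set r := rsubmx ybar; have rp : posvec R m r := posvec_rsubmx yp.
pose j0 : 'I_m := Ordinal m0; pose j1 : 'I_m := Ordinal m1.
pose v : 'rV[R]_m := \row_j (if j == j0 then r 0 j else 0).
pose u : 'rV[R]_m := \row_j (if j == j0 then 0 else r 0 j).
have u0 : 0 < s2 u.
  apply: is_norm_gt0 => //; apply/eqP => /rowP /(_ j1).
  by rewrite !mxE /= => /eqP; rewrite gt_eqF.
have B0 : 0 < s2 r := is_norm_gt0 s2N (posvec_neq0 m0 rp).
(* Chosen so that [s2 (t *: u)] exceeds [c * s2 r] even after losing [s2 v] in the triangle
   inequality for [t *: u = d - v]. *)
pose t := (c * s2 r + s2 v + 1) / s2 u.
have t0 : 0 < t.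
  by rewrite divr_gt0 // ltr_wpDl // addr_ge0 ?is_norm_ge0 // mulr_ge0 ?ltW.
pose d := t *: u + v.
have dp : posvec R m d.
  move=> j; rewrite !mxE; case: eqP => _; first by rewrite mulr0 add0r.
  by rewrite addr0 mulr_gt0.
have d0 : 0 < s2 d := is_norm_gt0 s2N (posvec_neq0 m0 dp).
have dB : c * s2 r < s2 d.
  have := is_normD s2N d (-1 *: v).
  rewrite (is_normZ s2N) normrN1 mul1r scaleN1r addrK is_normZ_gt0 //.
  rewrite /t divfK ?gt_eqF //; lra.
(* Rescaling by [a] returns [d] to the level set. As [d] agrees with [r] at [j0], the ratio there is
   [a^-1], which exceeds [c]. *)
pose a := s2 r / s2 d.
have a0 : 0 < a by rewrite divr_gt0.
exists (row_mx (lsubmx ybar) (a *: d)).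
  split; first by apply: posvec_row_mx; [exact: posvec_lsubmx|exact: posvecZ].
  by rewrite diff_scal_row_mx is_normZ_gt0 // /a divfK // gt_eqF.
exists (rshift 0 j0); rewrite ratio_rshift row_mxEr !mxE eqxx mulr0 add0r.
rewrite invfM mulrCA mulfV ?gt_eqF // mulr1 /a invf_div ltr_pdivlMr //.
Qed.

(** * Instances with an unsupported, badly approximated solution *)

Lemma unsupported_instance_mixed {R : realType} {k m : nat}
  (s1 : 'rV[R]_k -> R) (s2 : 'rV[R]_m -> R) (s1N : is_norm s1)
  (s2N : is_norm s2) (alpha : R) :
  (0 < k)%N -> (0 < m)%N -> 1 <= alpha ->
  exists I : instance R k m, ~ approximation_set I alpha
    (supported I (weighted_scalarization (posvec R (k + m)) (diff_scal s1 s2))).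
Proof.
move=> k0 m0 a1; have a0 : 0 < alpha by lra.
pose e := (2 * alpha)^-1.
have e0 : 0 < e by rewrite invr_gt0; lra.
have e1 : e < 1 by rewrite invf_lt1; lra.
pose y (a b : R) : 'rV[R]_(k + m) := row_mx (const_mx a) (const_mx b).
have yp a b : 0 < a -> 0 < b -> posvec R (k + m) (y a b).
  by move=> ? ?; apply: posvec_row_mx; apply: posvec_const.
pose z (j : 'I_3) := if j == 0 then y 1 1 else
  if j == 1 then y (2 * alpha) (2 * alpha) else y (e / 2) e.
apply: (@three_point_instance _ _ _ _ _ z) => //.
- by move=> j; rewrite /z; case: ifP => _; [|case: ifP => _]; apply: yp; lra.
- move=> j /negbTE j0; rewrite /z j0 eqxx; case: ifP => _.
    exists (lshift m (Ordinal k0)).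
    by rewrite ratio_lshift !row_mxEl !mxE divr1; lra.
  exists (rshift k (Ordinal m0)).
  by rewrite ratio_rshift !row_mxEr !mxE /e invrK; lra.
- move=> _ [w wp <-].
  have A0 := is_norm_gt0 s1N (posvec_neq0 k0 (posvec_lsubmx wp)).
  have B0 := is_norm_gt0 s2N (posvec_neq0 m0 (posvec_rsubmx wp)).
  have wE a b : 0 < a -> 0 < b -> weighted (diff_scal s1 s2) w (y a b) =
      a * s1 (lsubmx w) - b * s2 (rsubmx w).
    by move=> ? ?; rewrite weighted_diff_scal !weighted_const.
  (* If the score of all-ones is negative, enlarging it by [2 * alpha] lowers it. Otherwise
     shrinking by [e] does not raise it, and the extra halving of the first block makes the decrease
     strict even at score zero. *)
  have [AB|BA] := ltP (s1 (lsubmx w)) (s2 (rsubmx w)).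
    by exists 1; rewrite /z /= !wE //; [nra|lra|lra].
  by exists 2; rewrite /z /= !wE //; [nra|lra].
Qed.

Lemma unsupported_instance_max {R : realType} {m : nat}
  (s1 : 'rV[R]_0 -> R) (s2 : 'rV[R]_m -> R)
  (s2N : is_norm s2) (s2M : strictly_monotone s2) (alpha : R) :
  (1 < m)%N -> 1 <= alpha ->
  exists I : instance R 0 m, ~ approximation_set I alpha
    (supported I (weighted_scalarization (posvec R (0 + m)) (diff_scal s1 s2))).
Proof.
move=> m1 a1; have m0 := ltnW m1; have a0 : 0 < alpha by lra.
pose e := (2 * alpha)^-1.
have e0 : 0 < e by rewrite invr_gt0; lra.
pose j0 : 'I_m := Ordinal m0; pose j1 : 'I_m := Ordinal m1.
pose r (i : 'I_m) : 'rV[R]_m := \row_j (if j == i then e else 3).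
have rp i : posvec R m (r i) by move=> j; rewrite mxE; case: ifP => _ //; lra.
pose z (j : 'I_3) : 'rV[R]_(0 + m) := row_mx (const_mx 1)
  (if j == 0 then const_mx 1 else if j == 1 then r j0 else r j1).
apply: (@three_point_instance _ _ _ _ _ z) => //.
- move=> j; apply: posvec_row_mx; first exact: posvec_const.
  by case: ifP => _; [exact: posvec_const|case: ifP].
- move=> j /negbTE h; exists (rshift 0 (if j == 1 then j0 else j1)).
  rewrite ratio_rshift !row_mxEr h.
  by case: ifP => _; rewrite !mxE eqxx /e invrK; lra.
- move=> _ [w wp <-].
  set v := rsubmx w; have vp : posvec R m v := posvec_rsubmx wp.
  pose q i : 'rV[R]_m := \row_j (v 0 j * r i 0 j).
  have qE i : weighted s2 v (r i) = s2 (q i) by [].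
  (* Since [j0] and [j1] differ, the small entries never meet: every coordinate of [r j0 + r j1] is
     at least [3 + e]. *)
  have : s2 (2 *: v) < s2 (q j0 + q j1).
    apply: s2M => i; first by apply: posvecZ.
      by rewrite !mxE addr_gt0 // mulr_gt0 //; case: ifP => _ //; lra.
    rewrite !mxE; have := vp i; rewrite mxE.
    case: eqP => [->|_]; first by rewrite /=; nra.
    by case: ifP => _; nra.
  have := is_normD s2N (q j0) (q j1).
  rewrite is_normZ_gt0 // => hD hM.
  have wE j : weighted (diff_scal s1 s2) w (z j) =
      weighted s1 (lsubmx w) (const_mx 1) - weighted s2 v
        (if j == 0 then const_mx 1 else if j == 1 then r j0 else r j1).
    by rewrite weighted_diff_scal.
  (* The [s1] term is common to all three points, so a larger [s2] means a smaller score. *)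
  have [h|h] := ltP (s2 v) (s2 (q j0)).
    by exists 1; rewrite !wE /= (weighted_const s2N) // qE; lra.
  by exists 2; rewrite !wE /= (weighted_const s2N) // qE; lra.
Qed.

Theorem theorem5p8 (R : realType) (k m : nat)
  (hm : (0 < m)%N) (hp : (1 < k + m)%N)
  (s1 : 'rV[R]_k -> R) (s2 : 'rV[R]_m -> R)
  (s1_norm : is_norm s1) (s1_mono : (0 < k)%N -> strictly_monotone s1)
  (s2_norm : is_norm s2) (s2_mono : strictly_monotone s2) :
  let s := diff_scal s1 s2 in
  let S := weighted_scalarization (posvec R (k + m)) s in
  (forall alpha : R, 1 <= alpha ->
     exists I : instance R k m,
       ~ approximation_set I alpha (supported I S)) /\
  ereal_inf [set ereal_sup [set max_ratio y ybar | y in level_set ybar s]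
            | ybar in posvec R (k + m)] = +oo%E.
Proof.
move=> s S; split=> [alpha a1|].
  case: (posnP k) => [k0|k0]; last exact: unsupported_instance_mixed.
  (* With [k = 0], [hp] provides the second maximized objective. *)
  by subst k; apply: unsupported_instance_max.
(* The supremum is already infinite for each single [ybar]. *)
apply/ereal_inf_pinfty => _ [ybar yp <-].
apply: sup_max_ratio_pinfty => c c0.
case: (posnP k) => [k0|k0]; last exact: unbounded_ratio_mixed.
by subst k; apply: unbounded_ratio_max.
Qed.
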